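(* If the input graph $G$ on $n$ vertices is triangle-free, then the problem MT-recognition can be solved on $G$ in time $\mathcal{O}(n^4)$.
   Context: All graphs are finite and simple. A graph $G$ is Maya-Tupi if its vertex set can be partitioned into two (possibly empty) sets $A$ and $B$ such that $\delta(G[A])\ge |A|-2$ (every vertex of $A$ is non-adjacent to at most one other vertex of $A$) and $\Delta(G[B])\le 1$. The decision problem MT-recognition is: given a graph $G$, is $G$ Maya-Tupi? *)

(* Defs.v *)
From mathcomp Require Import all_boot.

Set Implicit Arguments.
Unset Strict Implicit.
Unset Printing Implicit Defensive.

Section Graphs.

Variables (V : finType) (e : rel V).

Definition simple_graph := symmetric e /\ irreflexive e.

Definition triangle_free :=
  [forall x, forall y, forall z, ~~ [&& e x y, e y z & e x z]].

Definition induced_degree (A : {set V}) (x : V) := #|[set y in A | e x y]|.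

(* An induced degree never exceeds #|A|, so the initial value #|A| of the
   iterated minimum is absorbed as soon as A is nonempty. *)
Definition induced_min_degree (A : {set V}) :=
  \big[minn/#|A|]_(x in A) induced_degree A x.

Definition induced_max_degree (B : {set V}) :=
  \max_(x in B) induced_degree B x.

(* Truncating #|A| - 2 at 0 is harmless: degrees are nonnegative. *)
Definition maya_tupi :=
  [exists A : {set V},
    (#|A| - 2 <= induced_min_degree A) && (induced_max_degree (~: A) <= 1)].

End Graphs.

(* Unit-cost word RAM. A configuration has registers r0, r1, ... and a memory of
   words; a program, being a finite list, mentions finitely many registers. Words
   have w bits: constants, sums and products are reduced modulo 2 ^ w, and
   subtraction is truncated at 0. *)
Inductive instr :=
  | Const of nat & nat        (* Const r c   : r := c               *)
  | Add of nat & nat & nat    (* Add r a b   : r := a + b           *)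
  | Sub of nat & nat & nat    (* Sub r a b   : r := a - b           *)
  | Mul of nat & nat & nat    (* Mul r a b   : r := a * b           *)
  | Read of nat & nat         (* Read r a    : r := memory[a]       *)
  | Write of nat & nat        (* Write a b   : memory[a] := b       *)
  | Jump of nat               (* Jump l      : go to line l         *)
  | JumpLt of nat & nat & nat (* JumpLt a b l : if a < b go to line l *)
  | Halt of bool.             (* stop and answer yes or no          *)

Definition program := seq instr.

Record config := Config { pc : nat; registers : nat -> nat; memory : nat -> nat }.

Definition upd (f : nat -> nat) (i v : nat) : nat -> nat :=
  fun j => if j == i then v else f j.

Definition exec (w : nat) (i : instr) (s : config) : config :=
  let: Config l r m := s in
  match i with
  | Const d c => Config l.+1 (upd r d (c %% 2 ^ w)) m
  | Add d a b => Config l.+1 (upd r d ((r a + r b) %% 2 ^ w)) m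
  | Sub d a b => Config l.+1 (upd r d (r a - r b)) m
  | Mul d a b => Config l.+1 (upd r d ((r a * r b) %% 2 ^ w)) m
  | Read d a => Config l.+1 (upd r d (m (r a))) m
  | Write a b => Config l.+1 r (upd m (r a) (r b))
  | Jump l' => Config l' r m
  | JumpLt a b l' => Config (if r a < r b then l' else l.+1) r m
  | Halt _ => s
  end.

(* The answer of the program if it halts within t steps (the Halt instruction
   included), None otherwise; leaving the program text is not halting. *)
Fixpoint run (w : nat) (P : program) (t : nat) (s : config) : option bool :=
  if t is t'.+1 then
    match onth P (pc s) with
    | None => None
    | Some (Halt b) => Some b
    | Some i => run w P t' (exec w i s)
    end
  else None.

(* A graph on 'I_n is given by its order, in register 0, and its adjacency
   matrix, stored row by row from address 0; everything else is 0. *)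
Definition input (n : nat) (e : rel 'I_n) : config :=
  Config 0 (fun r => if r == 0 then n else 0)
    (fun a => [exists i : 'I_n, exists j : 'I_n, (a == i * n + j) && e i j]).

Definition word_length (k n : nat) := k * (trunc_log 2 n).+1.

Definition bigO (f g : nat -> nat) :=
  exists C N, forall n, N <= n -> f n <= C * g n.

(* One program, running on words of O(log n) bits, answers the question Q within
   T n steps on every simple graph of order n that satisfies the promise C. *)
Definition solvable_in_time (Q C : forall V : finType, rel V -> bool)
    (T : nat -> nat) :=
  exists (k : nat) (P : program), 0 < k /\
    forall (n : nat) (e : rel 'I_n), simple_graph e -> C 'I_n e ->
      run (word_length k n) P (T n) (input e) = Some (Q 'I_n e).

(* Main.v *)
(* In a triangle-free graph a set A inducing minimum degree at least |A| - 2 has at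
   most 4 vertices: if |A| >= 5, a vertex of A has three neighbours in A, one of
   which is adjacent to another one. The other part has maximum degree at most 1
   iff A meets every path on three vertices, and the condition on A is hereditary.
   So a bounded search tree suffices: find a path y - x, y - z missed by A, branch
   on which of its vertices to add to A, and give up after 4 additions; when no
   path is missed, check A. This takes O(n ^ 3) steps for each of the at most
   121 nodes of the tree. *)
Require Import Defs.
From mathcomp Require Import all_boot.
From mathcomp Require Import zify.

Set Implicit Arguments.
Unset Strict Implicit.
Unset Printing Implicit Defensive.

Lemma bigminn_le (I : finType) (P : pred I) (F : I -> nat) d i :
  P i -> \big[minn/d]_(j | P j) F j <= F i.
Proof.
move=> Pi; have : i \in index_enum I by rewrite mem_index_enum.
elim: (index_enum I) => // j s IH; rewrite inE big_cons => /predU1P[<-|/IH le].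
  by rewrite Pi geq_minl.
by case: ifP => // _; rewrite geq_min le orbT.
Qed.

(** * Bounded search tree *)

Section Graph.

Variables (V : finType) (e : rel V).

(** The condition of at most one non-neighbour, phrased on triples: in this form it passes to
    subsets at once and can be tested by nested loops over a short list. *)
Definition dense_triple (a b c : V) :=
  [&& a != b, a != c & b != c] ==> (e a b || e a c).

Definition dense (s : seq V) :=
  all (fun a => all (fun b => all (dense_triple a b) s) s) s.

(** The centre is [y]. The ends [x] and [z] may be adjacent, since only the degree of [y] outside
    [s] matters. *)
Definition missed_path (s : seq V) (y x z : V) :=
  [&& e y x, e y z, x != z & [&& y \notin s, x \notin s & z \notin s]].

Definition mt_part (A : {set V}) :=
  (#|A| - 2 <= induced_min_degree e A) && (induced_max_degree e (~: A) <= 1).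

(** Specification of a node of the search tree: [s] lists the vertices chosen so far and [m] is the
    number of additions left. *)
Definition extendable (m : nat) (s : seq V) :=
  [exists A : {set V}, [&& mt_part A, all [in A] s & #|A| <= size s + m]].

Lemma denseP (s : seq V) :
  reflect {in s & &, forall a b c, dense_triple a b c} (dense s).
Proof.
apply: (iffP allP) => [H a b c /H/allP Ha /Ha/allP Hb /Hb //|H a sa].
by apply/allP => b sb; apply/allP => c sc; apply: H.
Qed.

Lemma min_degreeP (A : {set V}) : irreflexive e ->
  reflect {in A & &, forall a b c, dense_triple a b c}
    (#|A| - 2 <= induced_min_degree e A).
Proof.
move=> irr.
(* [A] splits into the neighbours of [x], [x] itself (by irreflexivity) and the other
   non-neighbours. *)
have degE x : x \in A ->
    (#|A| - 2 <= induced_degree e A x) =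
    (#|[set y in A | (y != x) && ~~ e x y]| <= 1).
  move=> xA; rewrite /induced_degree.
  rewrite -(cardsID [set y | e x y] A).
  have -> : A :&: [set y | e x y] = [set y in A | e x y].
    by apply/setP => y; rewrite !inE.
  rewrite (cardsD1 x (A :\: _)) !inE irr xA /=.
  have -> : (A :\: [set y | e x y]) :\ x = [set y in A | (y != x) && ~~ e x y].
    by apply/setP => y; rewrite !inE; case: (y \in A); case: (e x y); case: eqP.
  lia.
have minP : reflect {in A, forall x, #|A| - 2 <= induced_degree e A x}
    (#|A| - 2 <= induced_min_degree e A).
  apply: (iffP idP) => [le x xA|H].
    exact: leq_trans le (bigminn_le _ _ xA).
  rewrite /induced_min_degree.
  (* The default [#|A|] of the minimum satisfies the bound as well, which also settles the empty
     set. *)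
  by elim/big_rec: _ => [|x d xA IH]; [exact: leq_subr | rewrite leq_min H].
apply: (iffP minP) => [H a b c aA bA cA|H a aA].
  apply/implyP => /and3P[ab ac bc]; apply: contraNT bc => /norP[nb nc].
  have := H a aA; rewrite degE // => /card_le1_eqP eqs; apply/eqP/eqs.
    by rewrite inE cA eq_sym ac.
  by rewrite inE bA eq_sym ab.
rewrite degE //; apply/card_le1_eqP => c b.
rewrite !inE => /and3P[cA ca nc] /and3P[bA ba nb]; apply/eqP.
have := H a b c aA bA cA.
by rewrite /dense_triple ![a == _]eq_sym ba ca (negPf nb) (negPf nc) implybF negbK.
Qed.

Lemma max_degreeP (A : {set V}) :
  reflect (forall y x z, ~~ missed_path (enum A) y x z)
    (induced_max_degree e (~: A) <= 1).
Proof.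
rewrite /induced_max_degree; apply: (iffP (bigmax_leqP _ _ _)) => [H y x z|H y yA].
  apply/negP => /and4P[yx yz xz]; rewrite !mem_enum => /and3P[yA xA zA].
  have /H/card_le1_eqP eqs : y \in ~: A by rewrite inE.
  by move/eqP: xz; apply; apply: eqs; rewrite !inE ?xA ?zA.
apply/card_le1_eqP => z x; rewrite !inE => /andP[zA yz] /andP[xA yx].
apply/eqP; apply: contraT => xz; have := H y x z.
by rewrite /missed_path yx yz xz !mem_enum xA zA -in_setC yA.
Qed.

Lemma mt_partP (A : {set V}) : irreflexive e ->
  reflect (dense (enum A) /\ forall y x z, ~~ missed_path (enum A) y x z)
    (mt_part A).
Proof.
move=> irr; apply: (iffP andP) => [[/(min_degreeP A irr) H /max_degreeP K]|[H K]].
  by split=> //; apply/denseP => a b c; rewrite !mem_enum; apply: H.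
split; last exact/max_degreeP.
apply/(min_degreeP A irr) => a b c aA bA cA.
by apply: (denseP _ H); rewrite mem_enum.
Qed.

Lemma dense_sub (s s' : seq V) : {subset s <= s'} -> dense s' -> dense s.
Proof.
move=> ss /denseP H; apply/denseP => a b c /ss sa /ss sb /ss sc; exact: H.
Qed.

Lemma missed_path_sub (s s' : seq V) y x z : {subset s <= s'} ->
  missed_path s' y x z -> missed_path s y x z.
Proof.
move=> ss; rewrite /missed_path => /and4P[-> -> -> /and3P[ys xs zs]] /=.
by apply/and3P; split; [move: ys|move: xs|move: zs]; apply: contra => /ss.
Qed.

(** In one direction [s] inherits density from [A]; in the other, [s] itself is a valid part. *)
Lemma extendable_leaf m (s : seq V) : irreflexive e ->
  (forall y x z, ~~ missed_path s y x z) -> extendable m s = dense s.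
Proof.
move=> irr H; apply/existsP/idP => [[A /and3P[/mt_partP[//|dA _] sA _]]|ds].
  by apply: dense_sub dA => x /(allP sA); rewrite mem_enum.
exists [set x in s]; apply/and3P; split.
- apply/mt_partP => //; split=> [|y x z].
    by apply: dense_sub ds => x; rewrite mem_enum inE.
  by apply: contra (H y x z); apply: missed_path_sub => v vs; rewrite mem_enum inE.
- by apply/allP => x; rewrite inE.
- by rewrite cardsE (leq_trans (card_size s)) ?leq_addr.
Qed.

(** A valid part contains one of the three vertices, which can be added to [s]. With no addition
    left, the size bound forces the part to equal [s], which misses all three. *)
Lemma extendable_branch m (s : seq V) y x z : irreflexive e -> uniq s ->
  missed_path s y x z ->
  extendable m s = if m is k.+1 then
    [|| extendable k (y :: s), extendable k (x :: s) | extendable k (z :: s)]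
  else false.
Proof.
move=> irr us Hp.
have hit A : mt_part A -> [|| y \in A, x \in A | z \in A].
  case/mt_partP => // _ /(_ y x z); apply: contraR => /norP[yA /norP[xA zA]].
  by case/and4P: Hp => yx yz xz _; rewrite /missed_path yx yz xz !mem_enum yA xA.
have full (A : {set V}) : #|A| <= size s -> all [in A] s -> A =i s.
  move=> leA /allP sA; have {}sA : s \subset A by apply/subsetP.
  have := subset_leq_card sA; rewrite (card_uniqP us) => le.
  by apply/fsym/subset_cardP => //; rewrite (card_uniqP us); lia.
apply/existsP/idP => [[A /and3P[mtA sA leA]]|].
  have {hit} := hit A mtA; case: m leA => [|m] leA.
    rewrite addn0 in leA; rewrite !(full A leA sA).
    by case/and4P: Hp => _ _ _ /and3P[/negPf-> /negPf-> /negPf->].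
  have step v : v \in A -> extendable m (v :: s).
    by move=> vA; apply/existsP; exists A; rewrite mtA /= vA sA addSnnS.
  by case/or3P => /step ->; rewrite ?orbT.
case: m => // m.
have step v : extendable m (v :: s) ->
    exists A, [&& mt_part A, all [in A] s & #|A| <= size s + m.+1].
  case/existsP => A /and3P[mtA /andP[_ sA] leA].
  by exists A; rewrite -addSnnS; apply/and3P.
by case/or3P => /step.
Qed.

Lemma mt_part_card (A : {set V}) : irreflexive e -> triangle_free e ->
  mt_part A -> #|A| <= 4.
Proof.
move=> irr tf /andP[degA _]; rewrite leqNgt; apply/negP => A5.
have /card_gt0P[a aA] : 0 < #|A| by lia.
have : 2 < induced_degree e A a.
  have : #|A| - 2 <= induced_degree e A a.
    exact: leq_trans degA (bigminn_le _ _ aA).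
  lia.
case/card_gt2P => b [c [d [[]]]]; rewrite !inE.
move=> /andP[bA ab] /andP[cA ac] /andP[dA ad] [bc cd db].
(* Density is used with centre [b]: an edge from [b] to [c] or [d] closes a triangle with [a]. *)
have /implyP := min_degreeP A irr degA b c d bA cA dA.
have no u v : e a u -> e a v -> ~~ e u v.
  move=> au av; move/forallP/(_ a)/forallP/(_ u)/forallP/(_ v): tf.
  by rewrite au av andbT.
rewrite bc cd eq_sym db (negPf (no _ _ ab ac)) (negPf (no _ _ ab ad)).
by move/(_ isT).
Qed.

Lemma maya_tupi_extendable : irreflexive e -> triangle_free e ->
  maya_tupi e = extendable 4 [::].
Proof.
move=> irr tf; apply: eq_existsb => A.
rewrite -/(mt_part A); case mtA: (mt_part A) => //=.
by rewrite (mt_part_card irr tf mtA).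
Qed.

End Graph.

(** * Structured programs *)

(* [For i c] runs [c] for i = 0, ..., n - 1, where n is in register 0; it needs
   1 in register 1. [If ts c1 c2] branches on the disjunction of the tests
   a < b for (a, b) in ts. *)
Inductive cmd :=
  | Skip
  | Do of instr
  | Seq of cmd & cmd
  | If of seq (nat * nat) & cmd & cmd
  | For of nat & cmd.

Notation "c1 ;; c2" := (Seq c1 c2) (at level 60, right associativity).

(** Leaving out [Write] keeps the memory fixed, so that commands act on registers only; leaving out
    jumps reserves control flow for the structured constructors. *)
Definition straight (i : instr) :=
  match i with
  | Const _ _ | Add _ _ _ | Defs.Sub _ _ _ | Mul _ _ _ | Read _ _ => true
  | _ => false
  end.

Definition target (i : instr) :=
  match i with
  | Const d _ | Add d _ _ | Defs.Sub d _ _ | Mul d _ _ | Read d _ => d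
  | _ => 0
  end.

Fixpoint targets (c : cmd) : seq nat :=
  match c with
  | Skip => [::]
  | Do i => [:: target i]
  | c1 ;; c2 | If _ c1 c2 => targets c1 ++ targets c2
  | For i c => i :: targets c
  end.

(** A loop body must not write its counter, the bound in register 0 or the increment in register 1;
    hence the number of rounds is known on entry. *)
Fixpoint wf (c : cmd) :=
  match c with
  | Skip => true
  | Do i => straight i
  | c1 ;; c2 | If _ c1 c2 => wf c1 && wf c2
  | For i c => [&& 1 < i, i \notin targets c, all (ltn 1) (targets c) & wf c]
  end.

(** Jumps are absolute, hence the start address [l]. In [If] the second branch directly follows the
    tests, so it is reached when all of them fail, and it ends with a jump over the first branch. *)
Fixpoint compile (l : nat) (c : cmd) : program :=
  match c with
  | Skip => [::]
  | Do i => [:: i]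
  | c1 ;; c2 =>
      let p1 := compile l c1 in p1 ++ compile (l + size p1) c2
  | If ts c1 c2 =>
      let p2 := compile (l + size ts) c2 in
      let l1 := (l + size ts + size p2).+1 in
      let p1 := compile l1 c1 in
      [seq JumpLt t.1 t.2 l1 | t <- ts] ++ p2 ++ Jump (l1 + size p1) :: p1
  | For i c =>
      let p := compile l.+3 c in
      [:: Const i 0; JumpLt i 0 l.+3; Jump (l.+3 + size p).+2] ++ p ++
      [:: Add i i 1; Jump l.+1]
  end.

(** An upper bound independent of the data: both branches of [If] are charged. A round of a loop
    pays for test, increment and jump back; the outer 3 pays for initialisation, the failing test
    and the exit jump. *)
Fixpoint cost (c : cmd) (n : nat) : nat :=
  match c with
  | Skip => 0
  | Do _ => 1
  | c1 ;; c2 => cost c1 n + cost c2 n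
  | If ts c1 c2 => (size ts).+1 + cost c1 n + cost c2 n
  | For _ c => 3 + n * (cost c n + 3)
  end.

Fixpoint depth (c : cmd) : nat :=
  match c with
  | Skip | Do _ => 0
  | c1 ;; c2 | If _ c1 c2 => maxn (depth c1) (depth c2)
  | For _ c => (depth c).+1
  end.

Lemma cost_poly c : exists K, forall n, 0 < n -> cost c n <= K * n ^ depth c.
Proof.
have widen n K d1 d2 : 0 < n -> d1 <= d2 -> K * n ^ d1 <= K * n ^ d2.
  by move=> n0 le; rewrite leq_mul // leq_pexp2l.
elim: c => [|i|c1 [K1 H1] c2 [K2 H2]|ts c1 [K1 H1] c2 [K2 H2]|i c [K H]] /=.
- by exists 0.
- by exists 1 => n _; rewrite expn0.
- exists (K1 + K2) => n n0; rewrite mulnDl leq_add //.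
    exact: leq_trans (H1 n n0) (widen _ _ _ _ n0 (leq_maxl _ _)).
  exact: leq_trans (H2 n n0) (widen _ _ _ _ n0 (leq_maxr _ _)).
- exists ((size ts).+1 + K1 + K2) => n n0; rewrite !mulnDl !leq_add //.
  + by rewrite leq_pmulr // expn_gt0 n0.
  + exact: leq_trans (H1 n n0) (widen _ _ _ _ n0 (leq_maxl _ _)).
  + exact: leq_trans (H2 n n0) (widen _ _ _ _ n0 (leq_maxr _ _)).
(* The 6 absorbs the loop overhead [3 + 3 * n]. *)
- exists (K + 6) => n n0; have := H n n0; rewrite expnS.
  have : 0 < n ^ depth c by rewrite expn_gt0 n0.
  nia.
Qed.

(** * Semantics of structured programs and correctness of compilation *)

Section Semantics.

Variables (w : nat) (m : nat -> nat).

Fixpoint eval (c : cmd) (r : nat -> nat) : nat -> nat :=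
  match c with
  | Skip => r
  | Do i => registers (exec w i (Config 0 r m))
  | c1 ;; c2 => eval c2 (eval c1 r)
  | If ts c1 c2 => if has (fun t => r t.1 < r t.2) ts then eval c1 r else eval c2 r
  | For i c =>
      iter (r 0) (fun s => let s' := eval c s in upd s' i ((s' i + s' 1) %% 2 ^ w))
        (upd r i (0 %% 2 ^ w))
  end.

Lemma eval_other c r j : j \notin targets c -> eval c r j = r j.
Proof.
elim: c r => [|i|c1 IH1 c2 IH2|ts c1 IH1 c2 IH2|i c IH] r //=.
- by rewrite inE; case: i => *; rewrite //= /upd ifN.
- by rewrite mem_cat => /norP[j1 j2]; rewrite IH2 ?IH1.
- by rewrite mem_cat => /norP[j1 j2]; case: ifP; rewrite ?IH2 ?IH1.
- rewrite inE => /norP[/negPf ji jc].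
  by elim: (r 0) => [|k IHk] /=; rewrite /upd ji // IH.
Qed.

(** Invariant rule for loops, indexed by the number of completed rounds. The bound on register 0
    prevents the counter from wrapping around modulo [2 ^ w]. *)
Lemma eval_For_ind (I : nat -> (nat -> nat) -> Prop) i c r :
  wf (For i c) -> r 0 < 2 ^ w -> r 1 = 1 ->
  I 0 (upd r i 0) ->
  (forall k s, k < r 0 -> (forall j, j \notin i :: targets c -> s j = r j) ->
    s i = k -> I k s -> I k.+1 (upd (eval c s) i k.+1)) ->
  I (r 0) (eval (For i c) r).
Proof.
move=> /= /and4P[i1 ic /allP c1 _] r0 r1 I0 IS; rewrite mod0n.
set f := fun s => _.
have other k j : j \notin i :: targets c -> iter k f (upd r i 0) j = r j.
  rewrite inE => /norP[/negPf ji jc].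
  by elim: k => [|k IHk] /=; rewrite /f /upd ji // eval_other.
have n1 : 1 \notin i :: targets c.
  by rewrite inE negb_or neq_ltn i1; apply/negP => /c1.
have fE k : k < r 0 -> iter k f (upd r i 0) i = k ->
    f (iter k f (upd r i 0)) = upd (eval c (iter k f (upd r i 0))) i k.+1.
  move=> kn ik; rewrite /f /=; congr upd.
  rewrite !eval_other ?ik ?other ?r1 ?modn_small ?addn1 //; last by case/norP: n1.
  by lia.
suff H k : k <= r 0 -> iter k f (upd r i 0) i = k /\ I k (iter k f (upd r i 0)).
  by have [] := H _ (leqnn _).
elim: k => [|k IHk] kn /=; first by rewrite /upd eqxx.
have [ik Ik] := IHk (ltnW kn).
rewrite fE //; split; first by rewrite /upd eqxx.
by apply: IS => // j; apply: other.
Qed.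

Variable P : program.

Definition code_at (l : nat) (q : program) := exists p1 p2,
  P = p1 ++ q ++ p2 /\ size p1 = l.

Lemma code_at_cat l q1 q2 : code_at l (q1 ++ q2) ->
  code_at l q1 /\ code_at (l + size q1) q2.
Proof.
case=> p1 [p2 [E <-]]; split; first by exists p1, (q2 ++ p2); rewrite E -catA.
by exists (p1 ++ q1), p2; rewrite E -!catA size_cat.
Qed.

Lemma code_at_cons l i q : code_at l (i :: q) -> onth P l = Some i /\ code_at l.+1 q.
Proof.
case=> p1 [p2 [E <-]]; split; first by rewrite E onth_cat ltnn subnn.
by exists (rcons p1 i), p2; rewrite E cat_rcons size_rcons.
Qed.

(* Quantifying over the remaining time t' avoids any monotonicity of [run]. *)
Definition reach (B : nat) (s s' : config) :=
  exists2 t, t <= B & forall t', run w P (t + t') s = run w P t' s'.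

Lemma reach_refl s : reach 0 s s.
Proof. by exists 0. Qed.

Lemma reach_trans B1 B2 s1 s2 s3 :
  reach B1 s1 s2 -> reach B2 s2 s3 -> reach (B1 + B2) s1 s3.
Proof.
move=> [t1 le1 H1] [t2 le2 H2]; exists (t1 + t2); first exact: leq_add.
by move=> t'; rewrite -addnA H1 H2.
Qed.

Lemma reach_leq B1 B2 s s' : B1 <= B2 -> reach B1 s s' -> reach B2 s s'.
Proof. by move=> le [t tB H]; exists t => //; apply: leq_trans le. Qed.

Lemma reach_exec i s : onth P (pc s) = Some i ->
  (if i is Halt _ then false else true) -> reach 1 s (exec w i s).
Proof. by move=> E H; exists 1 => // t'; rewrite add1n /= E; case: i H {E}. Qed.

Lemma reach_tests ts l l1 r : code_at l [seq JumpLt t.1 t.2 l1 | t <- ts] ->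
  reach (size ts) (Config l r m)
    (Config (if has (fun t => r t.1 < r t.2) ts then l1 else l + size ts) r m).
Proof.
elim: ts l => [|[a b] ts IH] l /=; first by rewrite addn0 => _; apply: reach_refl.
move=> /code_at_cons[/= E /IH {}IH].
apply: (@reach_trans 1 _ _ (Config (if r a < r b then l1 else l.+1) r m)).
  exact: (@reach_exec (JumpLt a b l1) (Config l r m)).
case: ifP => _ /=; last by rewrite -addSnnS.
exact: reach_leq (leq0n _) (reach_refl _).
Qed.

(** Simulation by induction on the command. Registers 0 and 1 survive every subcommand, so the
    induction hypotheses stay applicable and all costs refer to the same [r 0]. *)
Lemma reach_compile c l r : wf c -> all (ltn 1) (targets c) ->
  r 0 < 2 ^ w -> r 1 = 1 -> code_at l (compile l c) ->
  reach (cost c (r 0)) (Config l r m)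
    (Config (l + size (compile l c)) (eval c r) m).
Proof.
have keep c' r' j : all (ltn 1) (targets c') -> j < 2 -> eval c' r' j = r' j.
  by move=> /allP H jlt; apply: eval_other; apply/negP => /H /=; rewrite ltnNge -ltnS jlt.
elim: c l r => [|i|c1 IH1 c2 IH2|ts c1 IH1 c2 IH2|i c IH] l r.
- by move=> _ _ _ _ _; rewrite addn0; apply: reach_refl.
- move=> /= si _ _ _ /code_at_cons[E _]; rewrite addn1.
  have -> : Config l.+1 (registers (exec w i (Config 0 r m))) m =
      exec w i (Config l r m) by case: i si {E}.
  by apply: reach_exec => //; case: i si {E}.
- move=> /= /andP[w1 w2]; rewrite all_cat => /andP[t1 t2] r0 r1.
  move=> /code_at_cat[H1 H2]; rewrite size_cat addnA.
  apply: reach_trans (IH1 _ _ w1 t1 r0 r1 H1) _.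
  by rewrite -(keep c1 r 0) // in r0 *; apply: IH2 => //; rewrite keep.
- move=> /= /andP[w1 w2]; rewrite all_cat => /andP[t1 t2] r0 r1.
  set p2 := compile _ c2; set l1 := (_ + size p2).+1; set p1 := compile l1 c1.
  move=> /code_at_cat[Ht]; rewrite size_map => /code_at_cat[H2].
  rewrite -/p2 => /code_at_cons[J H1].
  have -> : l + size ([seq JumpLt t.1 t.2 l1 | t <- ts] ++
      p2 ++ Jump (l1 + size p1) :: p1)
      = l1 + size p1.
    by rewrite !size_cat size_map /= /l1; lia.
  have -> : (size ts).+1 + cost c1 (r 0) + cost c2 (r 0)
      = size ts + (cost c1 (r 0) + (cost c2 (r 0) + 1)) by lia.
  apply: reach_trans (reach_tests r Ht) _; case: ifP => _.
    by apply: reach_leq (IH1 _ _ w1 t1 r0 r1 H1); apply: leq_addr.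
  apply: (@reach_leq (cost c2 (r 0) + 1)); first exact: leq_addl.
  apply: reach_trans (IH2 _ _ w2 t2 r0 r1 H2) _.
  exact: (@reach_exec (Jump (l1 + size p1)) (Config _ (eval c2 r) m)).
- move=> wfi; case/and4P: (wfi) => i1 ic c1 wc _ r0 r1.
  rewrite [compile _ _]/=; set p := compile _ c.
  move=> /code_at_cons[E1] /code_at_cons[E2] /code_at_cons[E3].
  move=> /code_at_cat[Hp] /code_at_cons[E4] /code_at_cons[E5 _].
  have -> : l + size ([:: Const i 0; JumpLt i 0 l.+3; Jump (l.+3 + size p).+2] ++
      p ++ [:: Add i i 1; Jump l.+1]) = (l.+3 + size p).+2.
    by rewrite /= size_cat /=; lia.
  set lend := (_ + size p).+2 in E3 *.
  (* After [k] rounds the machine is back at the loop test, at address [l.+1]; the leading 1 is the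
     initialisation of the counter. *)
  pose Inv k s := [/\ s i = k, s 0 = r 0, s 1 = 1 &
    reach (1 + k * (cost c (r 0) + 3)) (Config l r m) (Config l.+1 s m)].
  have i0 : 0 == i = false by lia.
  have i1' : 1 == i = false by lia.
  have [ei e0 e1 R] : Inv (r 0) (eval (For i c) r).
    apply: eval_For_ind => // [|k s kn _ ik [_ s0 s1 R]].
    + rewrite /Inv /upd eqxx i0 i1'; split=> //.
      have := @reach_exec _ (Config l r m) E1 isT.
      by rewrite /= mod0n.
    + have c0 : eval c s 0 = r 0 by rewrite keep.
      have c1' : eval c s 1 = 1 by rewrite keep.
      have ci : eval c s i = k by rewrite eval_other.
      rewrite /Inv /upd eqxx i0 i1'; split=> //; rewrite -/(upd _ _ _).
      have -> : 1 + k.+1 * (cost c (r 0) + 3) =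
        (1 + k * (cost c (r 0) + 3)) + (1 + (cost c (r 0) + (1 + 1))) by lia.
      apply: reach_trans R _.
      have := @reach_exec _ (Config l.+1 s m) E2 isT; rewrite /= ik s0 kn => R.
      apply: reach_trans R _; rewrite -s0.
      have s0' := s0; rewrite -s0 in r0.
      apply: reach_trans (IH _ _ wc c1 r0 s1 Hp) _.
      have := @reach_exec _ (Config (l.+3 + size p) (eval c s) m) E4 isT.
      rewrite /= ci c1' addn1 modn_small; last by lia.
      move=> R; apply: reach_trans R _.
      exact: (@reach_exec _ (Config (l.+3 + size p).+1 _ m) E5 isT).
    (* The last two steps are the failing test and the exit jump. *)
    have -> : cost (For i c) (r 0) = 1 + r 0 * (cost c (r 0) + 3) + (1 + 1).
      by rewrite /=; lia.
    apply: reach_trans R _.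
    have := @reach_exec _ (Config l.+1 (eval (For i c) r) m) E2 isT.
    rewrite [exec _ _ _]/= -/(eval (For i c) r) ei e0 ltnn => R.
    apply: reach_trans R _.
    exact: (@reach_exec _ (Config l.+2 _ m) E3 isT).
Qed.

End Semantics.

(** * From commands to decision programs *)

Lemma runS w P t s : run w P t.+1 s =
  if onth P (pc s) is Some i then
    if i is Halt b then Some b else run w P t (exec w i s)
  else None.
Proof. by []. Qed.

(** The first instruction supplies the 1 that loops expect; the final test compares [d] with
    register 2, which holds 0. *)
Definition decide (c : cmd) (d : nat) : program :=
  let l := (size (compile 1 c)).+1 in
  Const 1 1 :: compile 1 c ++ [:: JumpLt 2 d l.+2; Halt false; Halt true].

Lemma run_decide w c d r m :
  wf c -> all (ltn 2) (targets c) -> 0 < w -> r 0 < 2 ^ w -> r 2 = 0 ->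
  run w (decide c d) (cost c (r 0) + 3) (Config 0 r m) =
  Some (0 < eval w m c (upd r 1 1) d).
Proof.
move=> wc tc w0 r0 r2; set P := decide c d; set l := (size (compile 1 c)).+1.
have at1 : code_at P 1 (compile 1 c).
  by exists [:: Const 1 1], [:: JumpLt 2 d l.+2; Halt false; Halt true].
have /code_at_cons[E1 /code_at_cons[E2 /code_at_cons[E3 _]]] :
    code_at P l [:: JumpLt 2 d l.+2; Halt false; Halt true].
  by exists (Const 1 1 :: compile 1 c), [::]; rewrite cats0.
have E0 : onth P 0 = Some (Const 1 1) by [].
set r' := upd r 1 1.
have start : reach w P 1 (Config 0 r m) (Config 1 r' m).
  have := @reach_exec w P _ (Config 0 r m) E0 isT.
  by rewrite /= modn_small // -{1}(expn0 2) ltn_exp2l.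
have tc1 : all (ltn 1) (targets c) by apply: sub_all tc => j; apply: ltnW.
have [t le] := reach_trans start (reach_compile m wc tc1 r0 (erefl : r' 1 = 1) at1).
move: P at1 start E0 E1 E2 E3 => P _ _ _ E1 E2 E3.
have {}le : t <= 1 + cost c (r 0) := le.
(* Two steps remain for the final test and [Halt]; surplus time is harmless because [run] stops at
   [Halt]. *)
have -> : cost c (r 0) + 3 = t + (1 + cost c (r 0) - t).+2 by lia.
move=> ->.
have e2 : eval w m c r' 2 = 0.
  by rewrite eval_other ?r2 //; apply/negP => /(allP tc).
rewrite runS E1 runS /exec e2.
by case: ifP => _; rewrite ?E2 ?E3.
Qed.

(** * The recognition program *)

(* Registers: 0 holds n, 1 holds 1, 2 holds 0, 3 the answer, 4 a flag, 5 to 7 the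
   loop indices, 8 and 9 scratch. The level with [m] vertices left to choose
   stores the path it finds in registers 10 + 3 * m, 11 + 3 * m, 12 + 3 * m. *)

Definition edge (d a b : nat) : cmd :=
  Do (Mul d a 0);; Do (Add d d b);; Do (Read d d).

(** The machine only compares by [<], so distinctness is the disjunction of both strict
    comparisons. *)
Definition if_all_distinct (ps : seq (nat * nat)) (c : cmd) : cmd :=
  foldr (fun p c' => If [:: (p.1, p.2); (p.2, p.1)] c' Skip) c ps.

Definition for_each (s : seq nat) (f : nat -> cmd) : cmd :=
  foldr (fun a c => f a;; c) Skip s.

(** Register 5 is the centre of the candidate path. Adding register 2, which holds 0, copies a
    register. A later path overwrites an earlier one. *)
Definition find_step (s : seq nat) (p q u : nat) : cmd :=
  edge 8 5 6;; edge 9 5 7;;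
  If [:: (2, 8)] (If [:: (2, 9)]
    (if_all_distinct ((6, 7) :: [seq (v, a) | v <- [:: 5; 6; 7], a <- s])
      (Do (Add p 5 2);; Do (Add q 6 2);; Do (Add u 7 2);; Do (Const 4 1)))
    Skip) Skip.

Definition find_path (s : seq nat) (p q u : nat) : cmd :=
  For 5 (For 6 (For 7 (find_step s p q u))).

Definition check_triple (a b c : nat) : cmd :=
  if_all_distinct [:: (a, b); (a, c); (b, c)]
    (edge 8 a b;; edge 9 a c;;
     If [:: (2, 8); (2, 9)] Skip (Do (Const 4 1))).

(** It is entered with flag 4 equal to 0, and a violated triple raises the flag. Register 3 is never
    cleared, so it accumulates a disjunction over the leaves. *)
Definition check (s : seq nat) : cmd :=
  for_each s (fun a => for_each s (fun b => for_each s (check_triple a b)));;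
  If [:: (2, 4)] Skip (Do (Const 3 1)).

(** The recursion is unrolled into program text, which is finite and independent of the graph; [s]
    therefore lists registers holding the chosen vertices. *)
Fixpoint search (m : nat) (s : seq nat) : cmd :=
  let p := 10 + 3 * m in let q := 11 + 3 * m in let u := 12 + 3 * m in
  Do (Const 4 0);; find_path s p q u;;
  If [:: (2, 4)]
    (if m is k.+1 then
       search k (p :: s);; search k (q :: s);; search k (u :: s)
     else Skip)
    (check s).

(** * Well-formedness, written registers and loop depth of the program *)

Lemma wf_if_all_distinct ps c : wf (if_all_distinct ps c) = wf c.
Proof. by elim: ps => //= p ps ->; rewrite andbT. Qed.

Lemma targets_if_all_distinct ps c : targets (if_all_distinct ps c) = targets c.
Proof. by elim: ps => //= p ps ->; rewrite cats0. Qed.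

Lemma depth_if_all_distinct ps c : depth (if_all_distinct ps c) = depth c.
Proof. by elim: ps => //= p ps ->; rewrite maxn0. Qed.

Lemma wf_for_each s f : (forall a, wf (f a)) -> wf (for_each s f).
Proof. by move=> H; elim: s => //= a s ->; rewrite H. Qed.

Lemma targets_for_each s f (T : pred nat) :
  (forall a, all T (targets (f a))) -> all T (targets (for_each s f)).
Proof. by move=> H; elim: s => //= a s IH; rewrite all_cat H. Qed.

Lemma depth_for_each s f : (forall a, depth (f a) = 0) -> depth (for_each s f) = 0.
Proof. by move=> H; elim: s => //= a s ->; rewrite H. Qed.

Lemma targets_find_step s p q u :
  targets (find_step s p q u) = [:: 8; 8; 8; 9; 9; 9; p; q; u; 4].
Proof. by rewrite /= !cats0 targets_if_all_distinct. Qed.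

Lemma targets_check s : all [in [:: 3; 4; 8; 9]] (targets (check s)).
Proof.
rewrite /= all_cat targets_for_each // => a; do 2![apply: targets_for_each => ?].
by rewrite targets_if_all_distinct.
Qed.

Lemma targets_find_path s p q u :
  targets (find_path s p q u) = [:: 5; 6; 7; 8; 8; 8; 9; 9; 9; p; q; u; 4].
Proof. by rewrite -(targets_find_step s). Qed.

Lemma wf_find_path s p q u : 9 < p -> 9 < q -> 9 < u -> wf (find_path s p q u).
Proof.
move=> p9 q9 u9.
have wfs : wf (find_step s p q u) by rewrite /= wf_if_all_distinct.
rewrite /find_path; move: (find_step _ _ _ _) (targets_find_step s p q u) wfs => c tc wfs.
rewrite /= tc wfs /= !inE; lia.
Qed.

Lemma wf_search m s : wf (search m s).
Proof.
have wfc t : wf (check t).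
  rewrite /= andbT; do 3![apply: wf_for_each => ?].
  by rewrite wf_if_all_distinct.
elim: m s => [|m IH] s; rewrite [search _ _]/=; move: (check s) (wfc s) => c wc.
  by have := @wf_find_path s 10 11 12; move: (find_path _ _ _ _) => f /= ->.
have := @wf_find_path s (10 + 3 * m.+1) (11 + 3 * m.+1) (12 + 3 * m.+1).
by move: (find_path _ _ _ _) => f /= ->; rewrite ?IH ?wc; lia.
Qed.

(** The next level up stores its path from register [13 + 3 * m] on, so a subsearch cannot destroy
    the paths of the levels above it. *)
Lemma targets_search m s :
  all (fun j => 2 < j < 13 + 3 * m) (targets (search m s)).
Proof.
have tc k t : all (fun j => 2 < j < 13 + 3 * k) (targets (check t)).
  apply: sub_all (targets_check t) => j; rewrite !inE; lia.
elim: m s => [|m IH] s; rewrite [search _ _]/=.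
  have := tc 0 s; move: (check s) => c {}tc.
  have := targets_find_path s 10 11 12; move: (find_path _ _ _ _) => f /= ->.
  by rewrite /= tc.
have := tc m.+1 s; move: (check s) => c {}tc.
have := targets_find_path s (10 + 3 * m.+1) (11 + 3 * m.+1) (12 + 3 * m.+1).
move: (find_path _ _ _ _) => f /= ->; rewrite /= !all_cat tc /=.
have IH' t : all (fun j => 2 < j < 13 + 3 * m.+1) (targets (search m t)).
  by apply: sub_all (IH t) => j; lia.
by rewrite !IH' /=; lia.
Qed.

(** Branching adds no loop: only [find_path] loops, and its calls are never nested. *)
Lemma depth_search m s : depth (search m s) = 3.
Proof.
have dc t : depth (check t) = 0.
  rewrite /= maxn0; do 3![apply: depth_for_each => ?].
  by rewrite depth_if_all_distinct.
have df p q u : depth (find_path s p q u) = 3 by rewrite /= depth_if_all_distinct.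
elim: m s df => [|m IH] s df; rewrite [search _ _]/=; move: (check s) (dc s) => c ec.
  by have := df 10 11 12; move: (find_path _ _ _ _) => f /= ->; rewrite ec.
have := df (10 + 3 * m.+1) (11 + 3 * m.+1) (12 + 3 * m.+1).
move: (find_path _ _ _ _) => f /= ->; rewrite ec !IH // => *;
  by rewrite /= depth_if_all_distinct.
Qed.

Lemma updE f i v j : upd f i v j = if j == i then v else f j.
Proof. by []. Qed.

(** * Correctness of the recognition program *)

Section Correctness.

Variables (n : nat) (e : rel 'I_n) (w : nat) (m : nat -> nat).
Hypotheses (w_gt0 : 0 < w) (ltn_w : n < 2 ^ w) (ltnn_w : n * n < 2 ^ w).
Hypothesis m_adj : forall i j : 'I_n, m (i * n + j) = e i j.

Notation eval := (eval w m).

Definition ready (r : nat -> nat) := [/\ r 0 = n, r 1 = 1 & r 2 = 0].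

Lemma ready_eval c r : all (ltn 2) (targets c) -> ready r -> ready (eval c r).
Proof.
move=> /allP tc [r0 r1 r2].
by split; rewrite eval_other //; apply/negP => /tc.
Qed.

(** Register [d] is overwritten before [b] is read, hence [b != d]. The address is below [n * n], so
    it does not wrap around. *)
Lemma eval_edge d a b r (i j : 'I_n) : r 0 = n -> b != d ->
  r a = i -> r b = j -> eval (edge d a b) r d = e i j.
Proof.
move=> r0 bd ra rb; rewrite /= !updE !eqxx (negPf bd) ra rb r0 -m_adj.
have := ltn_ord i; have := ltn_ord j => jn ni.
by rewrite !modn_small //; nia.
Qed.

Lemma eval_if_all_distinct ps c r :
  eval (if_all_distinct ps c) r =
  if all (fun p => r p.1 != r p.2) ps then eval c r else r.
Proof. by elim: ps => //= p ps ->; rewrite orbF -neq_ltn; case: (_ == _). Qed.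

(** Registers in [S] are scratch. Specifying the body from every state that agrees with [r] outside
    [S] lets the rule be nested. *)
Lemma eval_for_each r s f (B : pred nat) (S : pred nat) r0 :
  (forall a, all S (targets (f a))) ->
  (forall j, ~~ S j -> r0 j = r j) ->
  (forall a r', a \in s -> (forall j, ~~ S j -> r' j = r j) ->
    eval (f a) r' 4 = if B a then 1 else r' 4) ->
  eval (for_each s f) r0 4 = if has B s then 1 else r0 4.
Proof.
move=> tf; elim: s r0 => //= a s IH r0 r0E H.
rewrite IH => [|j Sj|a' r' a's]; first last.
- by apply: H; rewrite inE a's orbT.
- by rewrite eval_other ?r0E //; apply: contra Sj => /(allP (tf a)).
rewrite H ?mem_head //; by case: (B a); case: has.
Qed.

Lemma all_neq_notin (T : eqType) (I : Type) (f : I -> T) x (s : seq I) :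
  all (fun i => x != f i) s = (x \notin map f s).
Proof. by elim: s => //= i s ->; rewrite inE negb_or. Qed.

Lemma mem_stored (r : nat -> nat) (rs : seq nat) (s : seq 'I_n) a :
  map r rs = map val s -> a \in rs -> exists i : 'I_n, r a = i.
Proof.
move=> rsE ars; have : r a \in map val s by rewrite -rsE map_f.
by case/mapP => i _ ->; exists i.
Qed.

Lemma eval_Seq c1 c2 r : eval (c1;; c2) r = eval c2 (eval c1 r).
Proof. by []. Qed.

Lemma eval_If ts c1 c2 r :
  eval (If ts c1 c2) r =
  if has (fun t => r t.1 < r t.2) ts then eval c1 r else eval c2 r.
Proof. by []. Qed.

Lemma eval_If_true ts c1 c2 r :
  has (fun t => r t.1 < r t.2) ts -> eval (If ts c1 c2) r = eval c1 r.
Proof. by rewrite eval_If => ->. Qed.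

Lemma eval_If_false ts c1 c2 r :
  ~~ has (fun t => r t.1 < r t.2) ts -> eval (If ts c1 c2) r = eval c2 r.
Proof. by rewrite eval_If => /negPf ->. Qed.

Lemma eval_check_triple a b c (i j k : 'I_n) r :
  ready r -> 9 < a -> 9 < b -> 9 < c -> r a = i -> r b = j -> r c = k ->
  eval (check_triple a b c) r 4 = if dense_triple e i j k then r 4 else 1.
Proof.
move=> [r0 r1 r2] a9 b9 c9 ra rb rc; rewrite eval_if_all_distinct.
rewrite /dense_triple -!val_eqE [all _ _]/= ra rb rc andbT; case: ifP => // _.
rewrite -/(edge 8 a b) -/(edge 9 a c) eval_Seq eval_Seq.
have E1 : eval (edge 8 a b) r 8 = e i j by apply: eval_edge => //; lia.
have o1 x : x != 8 -> eval (edge 8 a b) r x = r x.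
  by move=> x8; rewrite eval_other // !inE (negPf x8).
move: (eval (edge 8 a b) r) E1 o1 => s s8 so.
have E2 : eval (edge 9 a c) s 9 = e i k.
  by apply: eval_edge; rewrite ?so //; lia.
have o2 x : x != 9 -> eval (edge 9 a c) s x = s x.
  by move=> x9; rewrite eval_other // !inE (negPf x9).
move: (eval (edge 9 a c) s) E2 o2 => t t9 to.
rewrite eval_If /has /= t9 !to // s8 so // r2 /=.
by case: (e i j); case: (e i k); rewrite /= ?updE ?to ?so // modn_small //
  -{1}(expn0 2) ltn_exp2l.
Qed.

Lemma eval_check (rs : seq nat) (s : seq 'I_n) r :
  ready r -> r 4 = 0 -> all (ltn 9) rs -> map r rs = map val s ->
  eval (check rs) r 3 = if dense e s then 1 else r 3.
Proof.
move=> rr r4 /allP rs9 rsE; rewrite eval_Seq eval_If.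
(* [F] is the violated triple condition on plain numbers. Through it, loops over registers and
   quantifiers over vertices meet in the common list of values. *)
pose F x y z := [&& x != y, x != z & y != z] &&
  ~~ ((0 < m (x * n + y)) || (0 < m (x * n + z))).
pose G (l : seq nat) := has (fun x => has (fun y => has (F x y) l) l) l.
pose S := [in [:: 4; 8; 9]].
have tt a b c : all S (targets (check_triple a b c)).
  by rewrite targets_if_all_distinct.
have ready' r' : (forall j, ~~ S j -> r' j = r j) -> ready r'.
  by case: rr => r0 r1 r2 H; split; rewrite H.
set c := for_each _ _.
have tc : all S (targets c) by do 3![apply: targets_for_each => ?]; apply: tt.
have c4 : eval c r 4 = ~~ dense e s.
  have -> : ~~ dense e s = G (map r rs).
    rewrite rsE /dense /G -has_predC has_map; apply: eq_has => i /=.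
    rewrite -has_predC has_map; apply: eq_has => j /=.
    rewrite -has_predC has_map; apply: eq_has => k /=.
    by rewrite /F !m_adj /dense_triple negb_imply -!val_eqE; case: (e i j); case: (e i k).
  transitivity (if G (map r rs) then 1 else r 4); last by rewrite r4; case: (G _).
  have -> : G (map r rs) =
      has (fun a => has (fun b => has (fun c => F (r a) (r b) (r c)) rs) rs) rs.
    rewrite /G has_map; apply: eq_has => a /=.
    by rewrite has_map; apply: eq_has => b /=; rewrite has_map.
  apply: (@eval_for_each r _ _ _ S) => // [a|a r' ars r'E].
    by do 2![apply: targets_for_each => ?]; apply: tt.
  apply: (@eval_for_each r _ _ _ S) => // [b|b {r' r'E}r' brs r'E].
    by apply: targets_for_each => ?; apply: tt.
  apply: (@eval_for_each r _ _ _ S) => // {r' r'E}d r' drs r'E.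
  have [i ri] := mem_stored rsE ars; have [j rj] := mem_stored rsE brs.
  have [k rk] := mem_stored rsE drs.
  have out x : x \in rs -> r' x = r x.
    by move/rs9 => /= x9; apply: r'E; rewrite /S /= !inE; lia.
  rewrite (@eval_check_triple _ _ _ i j k _ (ready' _ r'E)
      (rs9 _ ars) (rs9 _ brs) (rs9 _ drs))
    ?(out _ ars) ?(out _ brs) ?(out _ drs) //.
  rewrite ri rj rk /F !m_adj /dense_triple -!val_eqE.
  by case: [&& _, _ & _]; case: (e i j); case: (e i k).
have o3 x : ~~ S x -> eval c r x = r x.
  by move=> Sx; rewrite eval_other //; apply: contra Sx => /(allP tc).
case: rr => r0 r1 r2.
rewrite /has /= o3 // r2 c4; case: (dense e s) => /=; last by rewrite o3.
by rewrite updE /= modn_small // -{1}(expn0 2) ltn_exp2l.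
Qed.

(** [V] is the set of triples tried so far. Once the flag is 1, any missed path serves for
    branching, wherever it was found. *)
Definition recorded (p q u : nat) (s : seq 'I_n) (V : 'I_n -> 'I_n -> 'I_n -> bool)
    (r : nat -> nat) :=
  (r 4 = 0 /\ forall y x z, V y x z -> ~~ missed_path e s y x z) \/
  (r 4 = 1 /\ exists y x z : 'I_n,
     [/\ missed_path e s y x z, r p = y, r q = x & r u = z]).

Lemma eval_find_step (p q u : nat) rs (s : seq 'I_n)
    (V V' : 'I_n -> 'I_n -> 'I_n -> bool) r (y x z : 'I_n) :
  uniq [:: p; q; u] -> all (ltn 9) [:: p; q; u] -> all (ltn 9) rs ->
  ready r -> map r rs = map val s -> r 5 = y -> r 6 = x -> r 7 = z ->
  (forall y' x' z', V' y' x' z' -> V y' x' z' || ((y', x', z') == (y, x, z))) ->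
  recorded p q u s V r -> recorded p q u s V' (eval (find_step rs p q u) r).
Proof.
move=> upqu pqu9 /allP rs9 [r0 r1 r2] rsE ry rx rz V'V R.
rewrite /find_step eval_Seq eval_Seq.
have E1 : eval (edge 8 5 6) r 8 = e y x by apply: eval_edge.
have o1 i : i != 8 -> eval (edge 8 5 6) r i = r i.
  by move=> i8; rewrite eval_other // !inE (negPf i8).
move: (eval (edge 8 5 6) r) E1 o1 => t t8 to.
have E2 : eval (edge 9 5 7) t 9 = e y z by apply: eval_edge; rewrite ?to.
have o2 i : i != 9 -> eval (edge 9 5 7) t i = t i.
  by move=> i9; rewrite eval_other // !inE (negPf i9).
move: (eval (edge 9 5 7) t) E2 o2 => v v9 vo.
have v8 : v 8 = e y x by rewrite vo.
have {t8 to vo}vo i : i != 8 -> i != 9 -> v i = r i.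
  by move=> i8 i9; rewrite vo ?to.
have vrs : map v rs = map val s.
  by rewrite -rsE; apply/eq_in_map => a /rs9 /= a9; apply: vo; lia.
have mem_s (i : 'I_n) : (nat_of_ord i \in map val s) = (i \in s).
  by rewrite (mem_map val_inj).
(* The nested tests compute [missed_path]: two edges, distinct ends, and each loop index distinct
   from each stored vertex. *)
have guardE c : eval (If [:: (2, 8)] (If [:: (2, 9)]
    (if_all_distinct ((6, 7) :: [seq (v, a) | v <- [:: 5; 6; 7], a <- rs]) c)
    Skip) Skip) v = if missed_path e s y x z then eval c v else v.
  rewrite !eval_If eval_if_all_distinct /= v8 v9 !vo // r2 rx rz.
  rewrite !all_cat !all_map /preim /= !(@all_neq_notin _ _ v) vrs.
  rewrite !vo // ry rx rz !mem_s /missed_path andbT.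
  case: (e y x); case: (e y z); rewrite //= orbF -neq_ltn -[nat_of_ord x == z]/(x == z).
  by case: (x == z).
rewrite guardE {guardE}.
have mod_ord (i : 'I_n) : (i + 0) %% 2 ^ w = i.
  by rewrite addn0 modn_small // (ltn_trans (ltn_ord i)).
case: ifP => Hp.
  right; move: pqu9 upqu; rewrite /= !inE !andbT => /and3P[p9 q9 u9].
  rewrite negb_or => /andP[/andP[pq pu] qu].
  split; first by rewrite updE /= modn_small // -{1}(expn0 2) ltn_exp2l.
  by exists y, x, z; split=> //; rewrite !updE eqxx;
    do ?[rewrite ifN; last by lia]; rewrite !vo ?r2 ?ry ?rx ?rz.
have vE i : i \in [:: 4; p; q; u] -> v i = r i.
  move=> H; apply: vo; move: H pqu9; rewrite !inE /=; lia.
case: R => [[r4 none]|[r4 [y' [x' [z' [Hp' rp rq ru]]]]]]; [left|right].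
  rewrite vE ?mem_head //; split=> // y' x' z' /V'V /orP[/none //|].
  by case/eqP => -> -> ->; rewrite Hp.
rewrite !vE ?inE ?eqxx ?orbT //; split=> //.
by exists y', x', z'.
Qed.

Definition loop_inv (p q u : nat) (rs : seq nat) (s : seq 'I_n)
    (V : 'I_n -> 'I_n -> 'I_n -> bool) (r : nat -> nat) :=
  [/\ ready r, map r rs = map val s & recorded p q u s V r].

Lemma loop_inv_upd p q u rs s V r i k :
  all (ltn 9) [:: p; q; u] -> all (ltn 9) rs -> 4 < i < 10 ->
  loop_inv p q u rs s V r -> loop_inv p q u rs s V (upd r i k).
Proof.
move=> pqu9 /allP rs9 i5 [[r0 r1 r2] rsE R].
have out j : (j < 5) || (9 < j) -> upd r i k j = r j.
  by move=> j5; rewrite updE ifN //; lia.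
move: pqu9; rewrite /= andbT => /and3P[p9 q9 u9].
split; first by split; rewrite out.
  by rewrite -rsE; apply/eq_in_map => a /rs9 /= a9; rewrite out ?a9 ?orbT.
by rewrite /recorded !out // ?p9 ?q9 ?u9 ?orbT.
Qed.

Lemma loop_inv_sub p q u rs s (V V' : 'I_n -> 'I_n -> 'I_n -> bool) r :
  (forall y x z, V' y x z -> V y x z) ->
  loop_inv p q u rs s V r -> loop_inv p q u rs s V' r.
Proof.
move=> VV' [rr rsE R]; split=> //; case: R => [[r4 none]|]; last by right.
by left; split=> // y x z /VV'; apply: none.
Qed.

Lemma eval_loop p q u rs s (V : nat -> 'I_n -> 'I_n -> 'I_n -> bool) i c r :
  all (ltn 9) [:: p; q; u] -> all (ltn 9) rs -> 4 < i < 10 -> wf (For i c) ->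
  loop_inv p q u rs s (V 0) r ->
  (forall (k : 'I_n) t, loop_inv p q u rs s (V k) t -> t i = k ->
    (forall j, j \notin i :: targets c -> t j = r j) ->
    loop_inv p q u rs s (V k.+1) (eval c t)) ->
  loop_inv p q u rs s (V n) (eval (For i c) r).
Proof.
move=> pqu9 rs9 i5 wfi inv0 invS.
have [[r0 r1 _] _ _] := inv0.
rewrite -[in V n]r0.
apply: (eval_For_ind (I := fun k => loop_inv p q u rs s (V k))) => //; rewrite ?r0 //.
  exact: loop_inv_upd.
move=> k t kn out ti inv; apply: loop_inv_upd => //.
exact: (invS (Ordinal kn)).
Qed.

Lemma eval_find_path p q u rs s r :
  uniq [:: p; q; u] -> all (ltn 9) [:: p; q; u] -> all (ltn 9) rs ->
  all [predC [:: p; q; u]] rs ->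
  ready r -> r 4 = 0 -> map r rs = map val s ->
  loop_inv p q u rs s (fun _ _ _ => true) (eval (find_path rs p q u) r).
Proof.
move=> upqu pqu9 rs9 rsNpqu rr r4 rsE.
have step_targets := targets_find_step rs p q u.
have loop_targets : targets (For 7 (find_step rs p q u)) =
  [:: 7; 8; 8; 8; 9; 9; 9; p; q; u; 4] by rewrite -step_targets.
have /and4P[_ _ _ w6] : wf (For 5 (For 6 (For 7 (find_step rs p q u)))).
  by apply: wf_find_path; case/and4P: pqu9.
have /and4P[_ _ _ w7] := w6.
have stepP (V : 'I_n -> 'I_n -> 'I_n -> bool) (y x z : 'I_n) t :
    loop_inv p q u rs s V t -> t 5 = y -> t 6 = x -> t 7 = z ->
    loop_inv p q u rs s (fun y' x' z' => V y' x' z' || ((y', x', z') == (y, x, z)))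
      (eval (find_step rs p q u) t).
  move=> [tr trs R] ty tx tz; split.
  - by apply: ready_eval => //; move: pqu9; rewrite step_targets /=; lia.
  - rewrite -trs; apply/eq_in_map => a ars; apply: eval_other.
    move/allP/(_ a ars): rsNpqu; move/allP/(_ a ars): rs9.
    by rewrite step_targets /= !inE; lia.
  by apply: (eval_find_step upqu pqu9 rs9 tr trs ty tx tz _ R).
(* The visited triples are an initial segment of the lexicographic order, given by one, two or three
   leading coordinates. A finished inner loop advances the coordinate outside it. *)
pose V3 (y x : 'I_n) (k : nat) (y' x' z' : 'I_n) :=
  (y' < y) || (y' == y) && ((x' < x) || (x' == x) && (z' < k)).
pose V2 (y : 'I_n) (k : nat) (y' x' z' : 'I_n) := (y' < y) || (y' == y) && (x' < k).
pose V1 (k : nat) (y' x' z' : 'I_n) := y' < k.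
apply: (@loop_inv_sub _ _ _ _ _ (V1 n)) => [y x z _|]; first exact: ltn_ord.
apply: eval_loop => // [||y t tinv ty _]; first by apply: wf_find_path; case/and4P: pqu9.
  by split=> //; left.
apply: (@loop_inv_sub _ _ _ _ _ (V2 y n)) => [y' x' z'|].
  by rewrite /V1 /V2 ltn_ord andbT ltnS leq_eqVlt orbC.
apply: eval_loop => // [|x t' tinv' tx out].
  by apply: loop_inv_sub tinv => y' x' z'; rewrite /V2 andbF orbF.
have ty' : t' 5 = y by rewrite out // loop_targets !inE; move: pqu9 => /=; lia.
apply: (@loop_inv_sub _ _ _ _ _ (V3 y x n)) => [y' x' z'|].
  by rewrite /V2 /V3 ltn_ord andbT ltnS (leq_eqVlt x') [_ || (x' < x)]orbC.
apply: eval_loop => // [|z t'' tinv'' tz out'].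
  by apply: loop_inv_sub tinv' => y' x' z'; rewrite /V3 andbF orbF.
have [y5 x6] : t'' 5 = y /\ t'' 6 = x.
  by rewrite !out' // step_targets !inE; move: pqu9 => /=; lia.
apply: loop_inv_sub (stepP _ _ _ _ _ tinv'' y5 x6 tz) => y' x' z'.
rewrite /V3 ltnS (leq_eqVlt z') !xpair_eqE -[nat_of_ord z' == z]/(z' == z).
by case: (y' < y); case: (y' == y); case: (x' < x); case: (x' == x);
  case: (z' == z); case: (z' < z).
Qed.

Lemma searchE k rs : search k rs =
  (Do (Const 4 0);; find_path rs (10 + 3 * k) (11 + 3 * k) (12 + 3 * k);;
   If [:: (2, 4)]
     (if k is k'.+1 then
        search k' (10 + 3 * k :: rs);; search k' (11 + 3 * k :: rs);;
        search k' (12 + 3 * k :: rs)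
      else Skip)
     (check rs)).
Proof. by case: k. Qed.

(** The program follows the leaf and branch equations of [extendable]. Keeping the old value of
    register 3 in the statement lets the three sibling searches be chained. *)
Lemma eval_search k rs s r : irreflexive e -> uniq s ->
  all (leq (13 + 3 * k)) rs -> ready r -> map r rs = map val s ->
  (0 < eval (search k rs) r 3) = (0 < r 3) || extendable e k s.
Proof.
move=> irr; elim/ltn_ind: k rs s r => k IH rs s r us /allP rs13 rr rsE.
rewrite searchE; set p := 10 + _; set q := 11 + _; set u := 12 + _.
rewrite eval_Seq eval_Seq.
have rs9 : all (ltn 9) rs by apply/allP => a /rs13 /=; lia.
pose r1 := eval (Do (Const 4 0)) r.
have r1E j : j != 4 -> r1 j = r j by move=> j4; rewrite /r1 /= updE ifN.
have r14 : r1 4 = 0 by rewrite /r1 /= updE /= mod0n.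
have [] : loop_inv p q u rs s (fun _ _ _ => true) (eval (find_path rs p q u) r1).
  apply: eval_find_path => //; rewrite /p /q /u.
  - by rewrite /= !inE; lia.
  - by apply/allP => a /rs13 /=; rewrite !inE; lia.
  by rewrite -rsE; apply/eq_in_map => a /rs13 /= a13; rewrite r1E //; lia.
have : eval (find_path rs p q u) r1 3 = r 3.
  by rewrite eval_other ?r1E // targets_find_path !inE /p /q /u; lia.
rewrite -/r1; move: (eval (find_path rs p q u) r1) => t t3 tr trs.
have [_ _ t2] := tr.
case=> [[t4 none]|[t4 [y [x [z [Hp tp tq tu]]]]]]; last first.
  rewrite eval_If_true; last by rewrite /= t2 t4.
  rewrite (extendable_branch k irr us Hp).
  case: k IH @p @q @u rs13 tp tq tu => [|k] IH p q u rs13 tp tq tu.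
    by rewrite orbF -t3.
  have [ys xs zs] : [/\ y \notin s, x \notin s & z \notin s].
    by case/and4P: Hp => _ _ _ /and3P[].
  (* One child search: it leaves registers from [13 + 3 * k] on intact, hence the path of this level
     and all chosen vertices are still there for the next sibling. *)
  have step a (i : 'I_n) t' : i \notin s -> 13 + 3 * k <= a ->
      (forall j, 13 + 3 * k <= j -> t' j = t j) -> ready t' -> t a = i ->
      [/\ (0 < eval (search k (a :: rs)) t' 3) = (0 < t' 3) || extendable e k (i :: s),
        (forall j, 13 + 3 * k <= j -> eval (search k (a :: rs)) t' j = t j) &
        ready (eval (search k (a :: rs)) t')].
    move=> is_ a13 t'E tr' ta; have /allP ts := targets_search k (a :: rs).
    split=> [|j j13|].
    - apply: IH => //=; rewrite ?is_ //.
        by rewrite a13; apply/allP => b /rs13 /=; lia.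
      rewrite t'E ?ta // -trs; congr cons; apply/eq_in_map => b /rs13 /= b13.
      by apply: t'E; lia.
    - by rewrite eval_other ?t'E //; apply/negP => /ts; lia.
    by apply: ready_eval => //; apply/allP => j /ts /=; lia.
  rewrite eval_Seq eval_Seq.
  have [p13 q13 u13] : [/\ 13 + 3 * k <= p, 13 + 3 * k <= q & 13 + 3 * k <= u].
    by rewrite /p /q /u; split; lia.
  have [pE poth pr] := step p y t ys p13 (fun _ _ => erefl) tr tp.
  have [qE qoth qr] := step q x _ xs q13 poth pr tq.
  have [uE _ _] := step u z _ zs u13 qoth qr tu.
  by rewrite uE qE pE t3 !orbA.
rewrite eval_If_false; last by rewrite /= t2 t4.
rewrite (eval_check tr t4 rs9 trs) t3 (@extendable_leaf _ e k s irr) => [|y x z];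
  last exact: none.
by case: (dense e s); rewrite ?orbT ?orbF.
Qed.

End Correctness.

(** * Running time and word length of the whole algorithm *)

Theorem corollary3p4 :
  exists T : nat -> nat,
    bigO T (fun n => n ^ 4) /\ solvable_in_time maya_tupi triangle_free T.
Proof.
pose c := search 4 [::].
have tc : all (ltn 2) (targets c).
  by apply: sub_all (targets_search 4 [::]) => j /andP[].
exists (fun n => cost c n + 3); split.
  have [K costK] := cost_poly c; exists (K + 3), 1 => n n0.
  have := costK n n0; rewrite depth_search.
  have : n ^ 3 <= n ^ 4 by rewrite leq_pexp2l.
  have : 0 < n ^ 4 by rewrite expn_gt0 n0.
  nia.
(* The factor 2 makes [2 ^ w] exceed [n * n], so that every matrix address fits in a word. *)
exists 2, (decide c 3); split=> // n e [_ irr] tf.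
set w := word_length 2 n; set m := memory (input e).
(* Since [j < n], the address determines [i] and [j] as quotient and remainder by [n]. *)
have m_adj (i j : 'I_n) : m (i * n + j) = e i j.
  have n0 : 0 < n by apply: leq_trans (ltn_ord i).
  rewrite /m /=; congr nat_of_bool; apply/existsP/idP => [[i' /existsP[j']]|eij].
    case/andP => /eqP E.
    have Ei : i = i'.
      apply: val_inj; have := congr1 (divn^~ n) E.
      by rewrite !divnMDl // !divn_small // !addn0.
    have Ej : j = j'.
      by apply: val_inj; have := congr1 (modn^~ n) E; rewrite !modnMDl !modn_small.
    by rewrite Ei Ej.
  by exists i; apply/existsP; exists j; rewrite eqxx.
have ltn_log : n < 2 ^ (trunc_log 2 n).+1 by apply: trunc_log_ltn.
have wE : 2 ^ w = 2 ^ (trunc_log 2 n).+1 * 2 ^ (trunc_log 2 n).+1.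
  by rewrite -expnD addnn -mul2n.
have ltnn_w : n * n < 2 ^ w by rewrite wE ltn_mul.
have ltn_w : n < 2 ^ w by rewrite wE; nia.
have w0 : 0 < w by rewrite /w /word_length; lia.
transitivity (Some (0 < eval w m c (upd (registers (input e)) 1 1) 3)).
  exact: (@run_decide w c 3 (registers (input e)) m (wf_search 4 [::]) tc w0 ltn_w).
congr Some; rewrite (maya_tupi_extendable irr tf).
by rewrite (@eval_search n e w m w0 ltn_w ltnn_w m_adj 4 [::] [::]).
Qed.
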